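(* Let $$A=\bigoplus_{i\in I}B(H_{\mathrm{in},i}),\quad B=\bigoplus_{j\in J}B(H_{\mathrm{out},j}),\quad C=\bigoplus_{k\in K}B(K_{\mathrm{in},k}),\quad D=\bigoplus_{l\in L}B(K_{\mathrm{out},l}),$$ and let $\mathcal S:\underline{\mathrm{Hom}}(A,B)\to\underline{\mathrm{Hom}}(C,D)$ be a deterministic supermap. Then there exist - a finite-dimensional Hilbert space $P$ with $\dim P\le \max_{i\in I,\,k\in K}\dim(H_{\mathrm{in},i})\dim(K_{\mathrm{in},k})$, - a channel $\mathcal E: C\to A\otimes B(P)=\bigoplus_{i\in I}B(H_{\mathrm{in},i}\otimes P)$, and - a channel $\mathcal G:\bigoplus_{(i,k,j)\in I\times K\times J}B(H_{\mathrm{out},j}\otimes P)\to D$ (that is, $\mathcal G:\bigoplus_{i\in I,k\in K}B\otimes B(P)\to D$), with the following property. For every channel $\mathcal F:A\to B$, let $\mathcal S(\mathcal F):C\to D$ denote the channel whose Choi operator is $\mathcal S(J(\mathcal F))$. Then for every $\rho=(\rho_k)_{k\in K}\in C$, $$\mathcal S(\mathcal F)(\rho)=\mathcal G(\omega),\qquad \omega_{(i,k,j)}:=\Big[(\mathcal F\otimes \mathrm{id}_{B(P)})\big(\iota_i\,\pi_i\,\mathcal E(\iota_k\rho_k)\big)\Big]_j\in B(H_{\mathrm{out},j}\otimes P).$$ Here $\iota_k\rho_k\in C$ is the element whose $k$-th block is $\rho_k$ and whose other blocks are $0$; $\pi_i$ extracts the $i$-th block $\in B(H_{\mathrm{in},i}\otimes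 P)$ of an element of $A\otimes B(P)$; $\iota_i$ re-embeds it into $A\otimes B(P)$ as the element supported on block $i$; and $[\,\cdot\,]_j$ is the $j$-th block of an element of $B\otimes B(P)=\bigoplus_j B(H_{\mathrm{out},j}\otimes P)$. Operationally: the classical input $k$ is copied; one copy with $\rho_k$ is fed into $\mathcal E$; the classical outcome $i$ of $\mathcal E$ is copied; one copy together with the $B(H_{\mathrm{in},i})$-part is fed into $\mathcal F$; and $\mathcal G$ receives $i,k$, the classical output $j$ of $\mathcal F$, and the quantum system $H_{\mathrm{out},j}\otimes P$.
   Context: Throughout, all Hilbert spaces are finite-dimensional and nonzero, and all index sets are finite and nonempty. **Multimatrix algebras.** A finite-dimensional $C^*$-algebra is written as $A=\bigoplus_{i\in I}B(H_i)$, with elements $X=(X_i)_{i\in I}$. Its trace is $\mathrm{Tr}(X)=\sum_i\mathrm{Tr}(X_i)$, and $X\ge 0$ means every block is positive semidefinite. A *state* of $A$ is a positive element of trace $1$. A *channel* $A\to B$ is a completely positive trace-preserving linear map. **Choi operators and (TP).** For $A=\bigoplus_{i\in I}B(H_i)$ and $B=\bigoplus_{j\in J}B(K_j)$, set $$\underline{\mathrm{Hom}}(A,B):=\bigoplus_{(j,i)\in J\times I}B(K_j\otimes H_i).$$ The Choi operator of a linear map $\mathcal F:A\to B$ is $J(\mathcal F)\in\underline{\mathrm{Hom}}(A,B)$ with $$J(\mathcal F)_{ji}=\sum_{a,b}\mathcal F(e^{(i)}_{ab})_j\otimes e^{(i)}_{ab},$$ where $e^{(i)}_{ab}$ are matrix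 units of $B(H_i)$ for a fixed orthonormal basis, regarded as elements of $A$ supported on block $i$, and $Y_j$ denotes the $j$-th block of $Y\in B$. - $\mathcal F\mapsto J(\mathcal F)$ is a linear bijection. - $\mathcal F$ is completely positive iff $J(\mathcal F)\ge 0$. - An element $X\in\underline{\mathrm{Hom}}(A,B)$ satisfies **(TP)** if $\sum_{j\in J}\mathrm{Tr}_{K_j}(X_{ji})=1_{H_i}$ for every $i\in I$. - A CP map is trace-preserving iff its Choi operator satisfies (TP). Hence the positive elements satisfying (TP) are exactly the Choi operators of channels. **Deterministic supermaps.** A deterministic supermap from channels $A\to B$ to channels $C\to D$ is a completely positive linear map $\mathcal S:\underline{\mathrm{Hom}}(A,B)\to\underline{\mathrm{Hom}}(C,D)$ that sends every positive element satisfying (TP) to an element satisfying (TP). *)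

(* Defs.v *)
(* Multimatrix algebras over a numeric closed field C (e.g. the complex numbers). *)
From HB Require Import structures.
From mathcomp Require Import all_boot all_order all_algebra.
From mathcomp Require Export mxtens.
Set Implicit Arguments. Unset Strict Implicit. Unset Printing Implicit Defensive.
Import Order.TTheory GRing.Theory Num.Theory.
Local Open Scope ring_scope.

(* A multimatrix algebra  (+)_{i in I} B(C^(d i)) : elements are families of square matrices. *)
Definition mm (C : numClosedFieldType) (I : finType) (d : I -> nat) : Type :=
  forall i : I, 'M[C]_(d i).

Section MM.
Variable C : numClosedFieldType.

Definition mm_zero (I : finType) (d : I -> nat) : mm C d := fun i => 0.
Definition mm_add (I : finType) (d : I -> nat) (X Y : mm C d) : mm C d :=
  fun i => X i + Y i.
Definition mm_scale (I : finType) (d : I -> nat) (a : C) (X : mm C d) : mm C d :=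
  fun i => a *: X i.

(* linear maps between multimatrix algebras *)
Definition mm_linear (I J : finType) (d : I -> nat) (e : J -> nat)
  (f : mm C d -> mm C e) : Prop :=
  forall (a : C) (X Y : mm C d),
    f (mm_add (mm_scale a X) Y) = mm_add (mm_scale a (f X)) (f Y).

(* positive semidefinite matrix: <v, M v> >= 0 for all vectors v *)
Definition psd (n : nat) (M : 'M[C]_n) : Prop :=
  forall v : 'cV[C]_n, 0 <= ((map_mx (fun x => x^*) v)^T *m M *m v) 0 0.

Definition mm_pos (I : finType) (d : I -> nat) (X : mm C d) : Prop :=
  forall i, psd (X i).

Definition mm_tr (I : finType) (d : I -> nat) (X : mm C d) : C :=
  \sum_i \tr (X i).

(* iota_i : element supported on block i *)
Definition mm_emb (I : finType) (d : I -> nat) (i : I) (X : 'M[C]_(d i)) : mm C d :=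
  fun i' => match i =P i' with
            | ReflectT e => eq_rect i (fun x => 'M[C]_(d x)) X i' e
            | ReflectF _ => 0
            end.

(* For X in B(C^m (x) C^n) (first tensor factor major, as in tensmx),
   the (a,b) sub-block in B(C^m). *)
Definition subblk (m n : nat) (X : 'M[C]_(m * n)) (a b : 'I_n) : 'M[C]_m :=
  \matrix_(p, q) X (mxtens_index (p, a)) (mxtens_index (q, b)).

(* partial trace over the first tensor factor: Tr_{C^m} : B(C^m (x) C^n) -> B(C^n) *)
Definition ptr1 (m n : nat) (X : 'M[C]_(m * n)) : 'M[C]_n :=
  \matrix_(a, b) \sum_(c < m) X (mxtens_index (c, a)) (mxtens_index (c, b)).

(* f (x) id_{B(C^n)} : (+)_i B(C^(d i) (x) C^n) -> (+)_j B(C^(e j) (x) C^n) *)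
Definition tens_id (I J : finType) (d : I -> nat) (e : J -> nat) (n : nat)
  (f : mm C d -> mm C e) (X : mm C (fun i => (d i * n)%N)) : mm C (fun j => (e j * n)%N) :=
  fun j => \sum_i \sum_(a < n) \sum_(b < n)
              (f (mm_emb (subblk (X i) a b)) j) *t delta_mx a b.

(* complete positivity: f (x) id_n is positive for every n *)
Definition mm_CP (I J : finType) (d : I -> nat) (e : J -> nat)
  (f : mm C d -> mm C e) : Prop :=
  forall (n : nat) (X : mm C (fun i => (d i * n)%N)), mm_pos X -> mm_pos (@tens_id I J d e n f X).

Definition mm_TP (I J : finType) (d : I -> nat) (e : J -> nat)
  (f : mm C d -> mm C e) : Prop :=
  forall X : mm C d, mm_tr (f X) = mm_tr X.

(* channel = completely positive trace-preserving linear map *)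
Definition channel (I J : finType) (d : I -> nat) (e : J -> nat)
  (f : mm C d -> mm C e) : Prop :=
  [/\ mm_linear f, mm_CP f & mm_TP f].

(* Hom(A,B) = (+)_{(j,i) in J x I} B(K_j (x) H_i) *)
Definition homdim (I J : finType) (d : I -> nat) (e : J -> nat) (p : J * I) : nat :=
  (e p.1 * d p.2)%N.

Definition HomS (I J : finType) (d : I -> nat) (e : J -> nat) : Type :=
  mm C (homdim d e).

(* Choi operator *)
Definition choi (I J : finType) (d : I -> nat) (e : J -> nat)
  (f : mm C d -> mm C e) : HomS d e :=
  fun p => \sum_(a < d p.2) \sum_(b < d p.2)
             (f (mm_emb (delta_mx a b : 'M[C]_(d p.2))) p.1) *t (delta_mx a b : 'M[C]_(d p.2)).

(* condition (TP) on elements of Hom(A,B) *)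
Definition TPcond (I J : finType) (d : I -> nat) (e : J -> nat) (X : HomS d e) : Prop :=
  forall i : I, \sum_(j : J) (@ptr1 (e j) (d i) (X (j, i)) : 'M[C]_(d i)) = 1%:M.

(* deterministic supermap *)
Definition det_supermap (I J K L : finType) (dI : I -> nat) (dJ : J -> nat)
  (dK : K -> nat) (dL : L -> nat) (S : HomS dI dJ -> HomS dK dL) : Prop :=
  [/\ mm_linear S, mm_CP S &
      forall X : HomS dI dJ, mm_pos X -> TPcond X -> TPcond (S X)].

End MM.

Arguments tens_id {C I J d e} n f X.

(* Main.v *)
(** Choi operators factor through positive square roots, so [S] is a Kraus map
    [X |-> sum_t M_t X M_t^*].  For [c] large [c 1 + X] is positive, hence the
    marginal [sum_l Tr_{K_out,l}] of [S X] vanishes as soon as all marginals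
    [sum_j Tr_{H_out,j}] of [X] do.  Consequently, if [w_{txy}] in H_in (x) K_in
    denotes the part of [M_t] between the basis vectors [y] of H_out and [x] of
    K_out, then [sum_{t,x} w_{txy} w_{txy'}^* = delta_{yy'} n] for a positive
    matrix [n] depending only on the blocks [i] and [k].  Factor [n = N N^*]
    through [P], with pseudo-inverse [N'].  The columns of [N] are the
    environment amplitudes of the encoder [E]; each [w_{txy}] lies in the range
    of [n], so [w = N (N' w)], and the vectors [N' w_{txy}] are the rows of the
    Kraus operators of [G], which is completed to a channel off the support of
    the projection [N' N]. *)
Require Import Defs.
From HB Require Import structures.
From mathcomp Require Import all_boot all_order all_algebra.
From mathcomp Require Import mxtens ring.
From Stdlib Require Import FunctionalExtensionality.
Set Implicit Arguments. Unset Strict Implicit. Unset Printing Implicit Defensive.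
Import Order.TTheory GRing.Theory Num.Theory.
Local Open Scope ring_scope.
Local Open Scope sesquilinear_scope.

(** * Positive semidefinite matrices *)

Section Psd.
Variable C : numClosedFieldType.

Lemma adjM m n p (A : 'M[C]_(m, n)) (B : 'M[C]_(n, p)) :
  (A *m B)^t* = B^t* *m A^t*.
Proof. by rewrite trmx_mul map_mxM. Qed.

Lemma adjD m n (A B : 'M[C]_(m, n)) : (A + B)^t* = A^t* + B^t*.
Proof. by rewrite linearD /= map_mxD. Qed.

Lemma adjB m n (A B : 'M[C]_(m, n)) : (A - B)^t* = A^t* - B^t*.
Proof. by rewrite linearB /= map_mxB. Qed.

Lemma adjZ m n a (A : 'M[C]_(m, n)) : (a *: A)^t* = a^* *: A^t*.
Proof. by rewrite linearZ /= map_mxZ. Qed.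

Lemma adj1 n : (1%:M : 'M[C]_n)^t* = 1%:M.
Proof. by rewrite trmx1 map_mx1. Qed.

Lemma psdE n (M : 'M[C]_n) :
  psd M <-> forall v : 'cV[C]_n, 0 <= (v^t* *m M *m v) 0 0.
Proof. by rewrite /psd; split=> h v; move: (h v); rewrite map_trmx. Qed.

Lemma psd_conj m n (A : 'M[C]_(m, n)) (M : 'M[C]_n) :
  psd M -> psd (A *m M *m A^t*).
Proof.
move=> /psdE h; apply/psdE => v.
by have := h (A^t* *m v); rewrite adjM trmxCK !mulmxA.
Qed.

Lemma psd1 n : psd (1%:M : 'M[C]_n).
Proof.
apply/psdE => v; rewrite mulmx1 mxE sumr_ge0 // => i _.
by rewrite !mxE mulrC mul_conjC_ge0.
Qed.

Lemma psd_gram m n (A : 'M[C]_(m, n)) : psd (A *m A^t*).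
Proof. by rewrite -{1}[A]mulmx1; apply/psd_conj/psd1. Qed.

Lemma psd0 n : psd (0 : 'M[C]_n).
Proof. by apply/psdE => v; rewrite mulmx0 mul0mx mxE. Qed.

Lemma psdD n (A B : 'M[C]_n) : psd A -> psd B -> psd (A + B).
Proof.
move=> /psdE hA /psdE hB; apply/psdE => v.
by rewrite mulmxDr mulmxDl mxE addr_ge0.
Qed.

Lemma psd_sum n (T : Type) (r : seq T) (P : pred T) (F : T -> 'M[C]_n) :
  (forall t, P t -> psd (F t)) -> psd (\sum_(t <- r | P t) F t).
Proof. by move=> h; apply: big_ind => //; [apply: psd0|apply: psdD]. Qed.

Lemma psdZ n a (A : 'M[C]_n) : 0 <= a -> psd A -> psd (a *: A).
Proof.
move=> ha /psdE hA; apply/psdE => v.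
by rewrite -scalemxAr -scalemxAl mxE mulr_ge0.
Qed.

Lemma psd_diag n (d : 'rV[C]_n) : (forall i, 0 <= d 0 i) -> psd (diag_mx d).
Proof.
move=> hd; apply/psdE => v; rewrite mul_mx_diag mxE sumr_ge0 // => i _.
by rewrite !mxE mulrAC mulr_ge0 // mulrC mul_conjC_ge0.
Qed.

Lemma psd_diag_ge0 n (A : 'M[C]_n) i : psd A -> 0 <= A i i.
Proof.
move=> /psdE /(_ (delta_mx i 0)); rewrite trmx_delta map_delta_mx.
by rewrite -rowE -colE !mxE.
Qed.

(** Polarisation: the form is real at [u + a *: v], so [a * f u v + a^* * f v u] is real for every
    [a]; the cases [a = 1] and [a = 'i] together give the symmetry. *)
Lemma form_hermC n (A : 'M[C]_n) (u v : 'cV[C]_n) : psd A ->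
  (u^t* *m A *m v) 0 0 = ((v^t* *m A *m u) 0 0)^*.
Proof.
move=> /psdE hA.
pose f (x y : 'cV[C]_n) := (x^t* *m A *m y) 0 0.
have fr x : f x x \is Num.real by rewrite ger0_real ?hA.
have fD a : f (u + a *: v) (u + a *: v) =
    f u u + a * a^* * f v v + (a * f u v + a^* * f v u).
  rewrite /f adjD adjZ !(mulmxDl, mulmxDr) -!(scalemxAl, scalemxAr) !mxE.
  ring.
have cr a : a * f u v + a^* * f v u \is Num.real.
  have -> : a * f u v + a^* * f v u =
     f (u + a *: v) (u + a *: v) - (f u u + a * a^* * f v v).
    by rewrite fD; ring.
  by rewrite rpredB // rpredD // rpredM // ger0_real // mul_conjC_ge0.
have /CrealP := cr 1; have /CrealP := cr 'i.
rewrite rmorph1 !mul1r conjCi !rmorphD !rmorphM /= !rmorphN /= conjCi.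
rewrite opprK => h2 h1; rewrite -/(f u v) -/(f v u).
have h3 : (f v u)^* - (f u v)^* = f u v - f v u.
  apply: (mulfI (neq0Ci C)); rewrite !mulrBr.
  by rewrite addrC -mulNr h2 mulNr.
have n2 : (2 : C) != 0 by rewrite pnatr_eq0.
apply: (mulfI n2); transitivity ((f u v + f v u) + (f u v - f v u)); first ring.
rewrite -h1 -h3; ring.
Qed.

Lemma psd_herm n (A : 'M[C]_n) : psd A -> A^t* = A.
Proof.
move=> hA; apply/matrixP => i j; rewrite !mxE.
have := form_hermC (delta_mx i 0) (delta_mx j 0) hA.
rewrite !trmx_delta !map_delta_mx -!rowE -!colE !mxE.
by move=> ->.
Qed.

Lemma herm_spectral n (A : 'M[C]_n) (P := spectralmx A) (d := spectral_diag A) :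
  A^t* = A ->
  [/\ P *m P^t* = 1%:M, P^t* *m P = 1%:M, A = P^t* *m diag_mx d *m P
    & forall i, d 0 i \is Num.real].
Proof.
move=> hA; have Ah : A \is hermsymmx.
  by apply/is_hermitianmxP; rewrite expr0 scale1r hA.
have /orthomx_spectralP := hermitian_normalmx Ah.
have Pu := spectral_unitarymx A; rewrite invmx_unitary // => eA.
split=> //; first exact/unitarymxP.
  by rewrite -invmx_unitary // mulVmx // unitarymx_unit.
by have /mxOverP h := hermitian_spectral_diag_real Ah.
Qed.

(** Each eigenvalue is at least minus the sum of all moduli. This crude bound is easy to add up over
    blocks. *)
Lemma herm_shift_psd n (A : 'M[C]_n) (c : C) : A^t* = A ->
  \sum_i `|spectral_diag A 0 i| <= c -> psd (c%:M + A).
Proof.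
move=> /herm_spectral; set P := spectralmx A; set d := spectral_diag A.
move=> [_ P1 -> dr] hc.
have -> : c%:M + P^t* *m diag_mx d *m P =
    P^t* *m diag_mx (const_mx c + d) *m P^t*^t*.
  rewrite trmxCK linearD /= diag_const_mx mulmxDr mulmxDl; congr (_ + _).
  by rewrite mul_mx_scalar -scalemxAl P1 scalemx1.
apply/psd_conj/psd_diag => i; rewrite !mxE.
have h : `|d 0 i| <= c.
  by apply: le_trans hc; rewrite (bigD1 i) //= lerDl sumr_ge0.
by rewrite -[d 0 i]opprK subr_ge0 (le_trans _ h) // -normrN real_ler_norm ?rpredN.
Qed.

(* [N'] is the Moore-Penrose inverse of [N], up to padding by zero columns. *)
Lemma psd_factor n p (A : 'M[C]_n) : (n <= p)%N -> psd A ->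
  exists N : 'M[C]_(n, p), exists N' : 'M[C]_(p, n),
    [/\ A = N *m N^t*, N *m N' *m N = N & (N' *m N)^t* = N' *m N].
Proof.
move=> le_np hA; have := herm_spectral (psd_herm hA).
set P := spectralmx A; set d := spectral_diag A => -[P1 P2 eA dr].
have d0 i : 0 <= d 0 i.
  have := psd_diag_ge0 i (psd_conj P hA).
  by rewrite {1}eA !mulmxA P1 mul1mx -mulmxA P1 mulmx1 mxE eqxx.
(* Since [0^-1 = 0], [s'] vanishes on the kernel of [A], as a Moore-Penrose inverse must. *)
pose s := \row_i sqrtC (d 0 i); pose s' := \row_i (sqrtC (d 0 i))^-1.
(* [J] appends [p - n] zero columns; [n <= p] makes [J *m J'] the identity. *)
pose J : 'M[C]_(n, p) := pid_mx n; pose J' : 'M[C]_(p, n) := pid_mx n.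
have JJ : J *m J' = 1%:M by rewrite mul_pid_mx minnn (minn_idPr le_np) pid_mx_1.
have aJ : J^t* = J' by rewrite tr_pid_mx map_pid_mx.
have aJ' : J'^t* = J by rewrite -aJ trmxCK.
have as_ (e : 'rV[C]_n) : (forall i, 0 <= e 0 i) -> (diag_mx e)^t* = diag_mx e.
  move=> he; rewrite tr_diag_mx map_diag_mx; congr diag_mx.
  by apply/rowP => i; rewrite mxE; apply: geC0_conj.
have s0 i : 0 <= s 0 i by rewrite mxE sqrtC_ge0.
have s'0 i : 0 <= s' 0 i by rewrite mxE invr_ge0 sqrtC_ge0.
exists (P^t* *m diag_mx s *m J), (J' *m diag_mx s' *m P); split.
- rewrite !adjM trmxCK as_ // aJ eA !mulmxA -[_ *m J *m J']mulmxA JJ mulmx1.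
  rewrite -[_ *m diag_mx s *m diag_mx s]mulmxA mulmx_diag; congr (_ *m diag_mx _ *m _).
  by apply/rowP => i; rewrite !mxE -expr2 sqrtCK.
- rewrite !mulmxA -[_ *m J *m J']mulmxA JJ mulmx1.
  rewrite -[_ *m P *m P^t*]mulmxA P1 mulmx1.
  rewrite -!mulmxA [diag_mx s' *m _]mulmxA [diag_mx s *m (_ *m _)]mulmxA.
  rewrite !mulmx_diag; congr (_ *m (diag_mx _ *m _)).
  apply/rowP => i; rewrite !mxE.
  by have [->|h] := eqVneq (sqrtC (d 0 i)) 0; rewrite ?mul0r // mulVf ?mulr1.
- rewrite !adjM trmxCK !as_ // aJ aJ' !mulmxA.
  rewrite -![_ *m P *m P^t*]mulmxA P1 !mulmx1.
  rewrite -![_ *m diag_mx _ *m diag_mx _]mulmxA !mulmx_diag.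
  by congr (_ *m diag_mx _ *m _); apply/rowP => i; rewrite !mxE mulrC.
Qed.

(** The diagonal entries of [A *m A^t*] are the squared norms of the rows of [A]. *)
Lemma gram_eq0 m n (A : 'M[C]_(m, n)) :
  (forall i, (A *m A^t*) i i = 0) -> A = 0.
Proof.
move=> h; apply/matrixP => i j; rewrite mxE; have /eqP := h i.
rewrite mxE psumr_eq0 => [/allP /(_ j)|l _]; last by rewrite !mxE mul_conjC_ge0.
by rewrite mem_index_enum !mxE mul_conjC_eq0 => /(_ isT) /eqP.
Qed.

(** The diagonals are nonnegative and sum to zero, so each vanishes; a factor of [A t] then has only
    zero rows. *)
Lemma psd_sum_eq0 n (T : finType) (A : T -> 'M[C]_n) :
  (forall t, psd (A t)) -> \sum_t A t = 0 -> forall t, A t = 0.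
Proof.
move=> hA h t; have [N [_ [eN _ _]]] := psd_factor (leqnn _) (hA t).
suff N0 : N = 0 by rewrite eN N0 mul0mx.
apply: gram_eq0 => i; rewrite -eN.
have /eqP := congr1 (fun M : 'M[C]_n => M i i) h; rewrite summxE mxE.
rewrite psumr_eq0 => [/allP /(_ t)|u _]; last exact: psd_diag_ge0.
by rewrite mem_index_enum => /(_ isT) /eqP.
Qed.

End Psd.

(** * Kraus maps *)

Lemma big_mxtens (V : nmodType) m n (F : 'I_(m * n) -> V) :
  \sum_z F z = \sum_x \sum_y F (mxtens_index (x, y)).
Proof.
rewrite pair_big (reindex (@mxtens_index m n)) /=; last first.
  by exists (@mxtens_unindex m n) => z _; rewrite ?mxtens_indexK ?mxtens_unindexK.
by apply: eq_bigr => -[].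
Qed.

Lemma tens_mxP (T : Type) m n p q (A B : 'M[T]_(m * n, p * q)) :
  (forall x y x' y', A (mxtens_index (x, y)) (mxtens_index (x', y')) =
                     B (mxtens_index (x, y)) (mxtens_index (x', y'))) -> A = B.
Proof.
move=> h; apply/matrixP => z z'.
by case: (mxtens_indexP z) => x y; case: (mxtens_indexP z') => x' y'.
Qed.

(** * Block embeddings, linear maps, Choi operators and Kraus maps *)

Section Multimatrix.
Variable C : numClosedFieldType.

(** The transport in [mm_emb] is along a proof of [i = i], trivial by uniqueness of identity proofs
    for decidable equality. *)
Lemma mm_emb_id (I : finType) (d : I -> nat) i (X : 'M[C]_(d i)) :
  mm_emb X i = X.
Proof. by rewrite /mm_emb; case: eqP => // e; rewrite (eq_axiomK e). Qed.

Lemma mm_emb_neq (I : finType) (d : I -> nat) i i' (X : 'M[C]_(d i)) :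
  i != i' -> mm_emb X i' = 0.
Proof. by rewrite /mm_emb; case: eqP. Qed.

Lemma mm_emb_sum (I : finType) (d : I -> nat) (T : finType) i i'
    (a : T -> C) (X : T -> 'M[C]_(d i)) :
  mm_emb (\sum_t a t *: X t) i' = \sum_t a t *: mm_emb (X t) i'.
Proof.
have [<-|h] := eqVneq i i'.
  by rewrite mm_emb_id; apply: eq_bigr => t _; rewrite mm_emb_id.
by rewrite mm_emb_neq // big1 // => t _; rewrite mm_emb_neq ?scaler0.
Qed.

Lemma sum_mm_emb (I : finType) (d : I -> nat) (V : nmodType) i
    (X : 'M[C]_(d i)) (F : forall i', 'M[C]_(d i') -> V) :
  (forall i', F i' 0 = 0) -> \sum_i' F i' (mm_emb X i') = F i X.
Proof.
move=> h; rewrite (bigD1 i) //= mm_emb_id big1 ?addr0 // => i' ne.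
by rewrite mm_emb_neq // eq_sym.
Qed.

Lemma mm_emb_pos (I : finType) (d : I -> nat) i (X : 'M[C]_(d i)) :
  psd X -> mm_pos (mm_emb X).
Proof.
move=> h i'; have [<-|ne] := eqVneq i i'; first by rewrite mm_emb_id.
by rewrite mm_emb_neq //; apply: psd0.
Qed.

Section Linear.
Variables (I J : finType) (d : I -> nat) (e : J -> nat).
Variables (f : mm C d -> mm C e) (hf : mm_linear f).

Lemma mm_linear0 j : f (fun=> 0) j = 0.
Proof.
have := congr1 (@^~ j) (hf (-1) (fun=> 0) (fun=> 0)).
rewrite /mm_add /mm_scale /= scaleN1r addNr => <-; congr (f _ j).
by apply: functional_extensionality_dep => i; rewrite scaler0 addr0.
Qed.

(** Combinations in [mm] are taken block by block; the explicit coefficients follow the shape of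
    [mm_linear]. *)
Lemma mm_linear_sum (T : finType) (a : T -> C) (X : T -> mm C d) j :
  f (fun i => \sum_t a t *: X t i) j = \sum_t a t *: f (X t) j.
Proof.
elim: (index_enum T) => [|t r IH].
  rewrite big_nil -[RHS](mm_linear0 j); congr (f _ j).
  by apply: functional_extensionality_dep => i; rewrite big_nil.
rewrite big_cons -IH -[RHS](congr1 (@^~ j) (hf _ _ _)); congr (f _ j).
by apply: functional_extensionality_dep => i; rewrite big_cons.
Qed.

Lemma mm_linear_emb i (X : 'M[C]_(d i)) j :
  f (mm_emb X) j = \sum_a \sum_b X a b *: f (mm_emb (delta_mx a b)) j.
Proof.
rewrite pair_big /= -(mm_linear_sum (fun p => X p.1 p.2)); congr (f _ j).
apply: functional_extensionality_dep => i' /=.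
rewrite -mm_emb_sum; congr (mm_emb _ i'); rewrite {1}[X]matrix_sum_delta.
by rewrite pair_big.
Qed.

Lemma mm_linear_split X j : f X j = \sum_i f (mm_emb (X i)) j.
Proof.
transitivity (\sum_i 1 *: f (mm_emb (X i)) j); last first.
  by apply: eq_bigr => i _; rewrite scale1r.
rewrite -mm_linear_sum; congr (f _ j); apply: functional_extensionality_dep => i'.
rewrite (bigD1 i') //= mm_emb_id scale1r big1 ?addr0 // => i ne.
by rewrite mm_emb_neq ?scaler0.
Qed.

Lemma choiE j i y a y' b :
  choi f (j, i) (mxtens_index (y, a)) (mxtens_index (y', b)) =
  f (mm_emb (delta_mx a b)) j y y'.
Proof.
rewrite /choi /= summxE (bigD1 a) //= [X in _ + X]big1 ?addr0 => [|a' na]; last first.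
  by rewrite summxE big1 // => b' _; rewrite tensmxE mxE eq_sym (negPf na) mulr0.
rewrite summxE (bigD1 b) //= [X in _ + X]big1 ?addr0 => [|b' nb]; last first.
  by rewrite tensmxE mxE [b == b']eq_sym (negPf nb) andbF mulr0.
by rewrite tensmxE mxE !eqxx mulr1.
Qed.

(** Inverse of the Choi correspondence: contracting the input indices of [choi f] with [X] recovers
    [f X]. *)
Lemma mm_linear_choi X j y y' :
  f X j y y' = \sum_i \sum_a \sum_b
    X i a b * choi f (j, i) (mxtens_index (y, a)) (mxtens_index (y', b)).
Proof.
rewrite mm_linear_split summxE; apply: eq_bigr => i _.
rewrite mm_linear_emb summxE; apply: eq_bigr => a _.
by rewrite summxE; apply: eq_bigr => b _; rewrite mxE choiE.
Qed.

Lemma tens_idE n (X : mm C (fun i => (d i * n)%N)) j y a y' b :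
  tens_id n f X j (mxtens_index (y, a)) (mxtens_index (y', b)) =
  \sum_i f (mm_emb (subblk (X i) a b)) j y y'.
Proof.
rewrite /tens_id summxE; apply: eq_bigr => i _.
rewrite summxE (bigD1 a) //= [X in _ + X]big1 ?addr0 => [|a' na]; last first.
  by rewrite summxE big1 // => b' _; rewrite tensmxE mxE eq_sym (negPf na) mulr0.
rewrite summxE (bigD1 b) //= [X in _ + X]big1 ?addr0 => [|b' nb]; last first.
  by rewrite tensmxE mxE [b == b']eq_sym (negPf nb) andbF mulr0.
by rewrite tensmxE mxE !eqxx mulr1.
Qed.

Lemma tens_id_emb n i (X : 'M[C]_(d i * n)) j y a y' b :
  tens_id n f (@mm_emb C I (fun i => (d i * n)%N) i X) j
    (mxtens_index (y, a)) (mxtens_index (y', b)) =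
  f (mm_emb (subblk X a b)) j y y'.
Proof.
rewrite tens_idE.
rewrite (@sum_mm_emb I (fun i => (d i * n)%N) _ i X
          (fun i' Z => f (mm_emb (subblk Z a b)) j y y')) // => i'.
have -> : mm_emb (subblk (0 : 'M[C]_(d i' * n)) a b) = fun=> 0.
  apply: functional_extensionality_dep => i0.
  have -> : subblk (0 : 'M[C]_(d i' * n)) a b = 0 by apply/matrixP => p q; rewrite !mxE.
  have [<-|ne] := eqVneq i' i0; first by rewrite mm_emb_id.
  by rewrite mm_emb_neq.
by rewrite mm_linear0 mxE.
Qed.

Lemma choi_psd : mm_CP f -> forall j i, psd (choi f (j, i)).
Proof.
move=> cp j i.
(* The unnormalised maximally entangled vector: tensoring [f] with the identity and applying it to
   [w *m w^t*] in block [i] yields the Choi block. *)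
pose w : 'cV[C]_(d i * d i) :=
  \col_z ((mxtens_unindex z).1 == (mxtens_unindex z).2)%:R.
have -> : choi f (j, i) =
    tens_id (d i) f (@mm_emb C I (fun i' => (d i' * d i)%N) i (w *m w^t*)) j.
  apply: tens_mxP => y a y' b; rewrite choiE tens_id_emb.
  congr (f (mm_emb _) j y y'); apply/matrixP => p q; rewrite !mxE big_ord1.
  by rewrite !mxE !mxtens_indexK /= conjC_nat -natrM mulnb.
by apply/cp/mm_emb_pos/psd_gram.
Qed.

End Linear.

(** The index type may depend on the pair of blocks: the operators completing the decoder are
    indexed by a basis of their source block. *)
Definition kraus (I J : finType) (d : I -> nat) (e : J -> nat)
    (T : J -> I -> finType) (M : forall j i, T j i -> 'M[C]_(e j, d i)) :
    mm C d -> mm C e :=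
  fun X j => \sum_i \sum_t M j i t *m X i *m (M j i t)^t*.

(** Conjugation by [A *t 1%:M] acts on each sub-block separately, so a Kraus map tensored with an
    identity is again a Kraus map. *)
Lemma subblk_conj m m' n (A : 'M[C]_(m', m)) (X : 'M[C]_(m * n)) a b :
  subblk ((A *t 1%:M) *m X *m (A *t 1%:M)^t*) a b = A *m subblk X a b *m A^t*.
Proof.
apply/matrixP => x x'; rewrite !mxE big_mxtens; apply: eq_bigr => q _.
rewrite (bigD1 b) //= big1 ?addr0 => [|c nc]; last first.
  by rewrite !mxE !mxtens_indexK /= [b == c]eq_sym (negPf nc) mulr0 conjC0 mulr0.
rewrite !mxE !mxtens_indexK /= eqxx mulr1; congr (_ * _).
rewrite big_mxtens; apply: eq_bigr => p _.
rewrite (bigD1 a) //= big1 ?addr0 => [|c nc]; last first.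
  by rewrite !mxE !mxtens_indexK /= [a == c]eq_sym (negPf nc) mulr0 mul0r.
by rewrite !mxE !mxtens_indexK /= eqxx mulr1.
Qed.

Section Kraus.
Variables (I J : finType) (d : I -> nat) (e : J -> nat).
Variables (T : J -> I -> finType) (M : forall j i, T j i -> 'M[C]_(e j, d i)).

Lemma kraus_linear : mm_linear (kraus M).
Proof.
move=> a X Y; apply: functional_extensionality_dep => j.
rewrite /mm_add /mm_scale /kraus scaler_sumr -big_split; apply: eq_bigr => i _.
rewrite scaler_sumr -big_split; apply: eq_bigr => t _ /=.
by rewrite mulmxDr mulmxDl -scalemxAr -scalemxAl.
Qed.

Lemma kraus_emb i (X : 'M[C]_(d i)) j :
  kraus M (mm_emb X) j = \sum_t M t *m X *m (M (j := j) t)^t*.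
Proof.
rewrite /kraus (@sum_mm_emb I d _ i X
  (fun i Z => \sum_t M t *m Z *m (M (j := j) t)^t*)) // => i'.
by rewrite big1 // => t _; rewrite mulmx0 mul0mx.
Qed.

Lemma kraus_CP : mm_CP (kraus M).
Proof.
move=> n X hX j.
have -> : tens_id n (kraus M) X j =
    \sum_i \sum_t (M t *t 1%:M) *m X i *m (M (j := j) (i := i) t *t 1%:M)^t*.
  apply: tens_mxP => y a y' b; rewrite tens_idE summxE; apply: eq_bigr => i _.
  rewrite kraus_emb !summxE; apply: eq_bigr => t _.
  by rewrite -subblk_conj mxE.
by apply: psd_sum => i _; apply: psd_sum => t _; apply/psd_conj/hX.
Qed.

Lemma kraus_TP :
  (forall i, \sum_j \sum_t (M (j := j) t)^t* *m M t = 1%:M :> 'M[C]_(d i)) ->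
  mm_TP (kraus M).
Proof.
move=> h X; rewrite /mm_tr /kraus.
under eq_bigr do rewrite raddf_sum /=.
rewrite exchange_big; apply: eq_bigr => i _ /=.
rewrite -{2}[X i]mul1mx -h mulmx_suml raddf_sum; apply: eq_bigr => j _ /=.
rewrite mulmx_suml !raddf_sum; apply: eq_bigr => t _ /=.
by rewrite mxtrace_mulC mulmxA.
Qed.

Lemma kraus_channel :
  (forall i, \sum_j \sum_t (M (j := j) t)^t* *m M t = 1%:M :> 'M[C]_(d i)) ->
  channel (kraus M).
Proof. by split; [apply: kraus_linear | apply: kraus_CP | apply: kraus_TP]. Qed.

End Kraus.

(** The columns of a factor [N] of each Choi block, reshaped into matrices, are the Kraus
    operators. *)
Lemma CP_kraus (I J : finType) (d : I -> nat) (e : J -> nat)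
    (f : mm C d -> mm C e) :
  mm_linear f -> mm_CP f ->
  exists n : nat, exists M : forall j i, 'I_n -> 'M[C]_(e j, d i),
    forall X, f X = kraus M X.
Proof.
(* One [n] serves all pairs of blocks, since factors may be padded with zero columns. *)
move=> lf cf; pose n := (\max_(p : J * I) (e p.1 * d p.2))%N.
have ch j i : {N : 'M[C]_(e j * d i, n) | choi f (j, i) = N *m N^t*}.
  apply: sig_eqW.
  have le_n : (e j * d i <= n)%N by apply: (leq_bigmax (j, i)).
  by have [N [_ [-> _ _]]] := psd_factor le_n (choi_psd lf cf (j := j) (i := i));
    exists N.
exists n, (fun j i t => \matrix_(x, y) sval (ch j i) (mxtens_index (x, y)) t) => X.
apply: functional_extensionality_dep => j; apply/matrixP => y y'.
rewrite (mm_linear_choi lf) summxE; apply: eq_bigr => i _.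
case: (ch j i) => N /= ->; rewrite summxE.
under [RHS]eq_bigr => t _ do rewrite -mulmxA mxE.
under [RHS]eq_bigr => t _ do under eq_bigr => a _ do rewrite !mxE mulr_sumr.
rewrite [RHS]exchange_big; apply: eq_bigr => a _ /=.
rewrite [RHS]exchange_big; apply: eq_bigr => b _ /=.
by rewrite mxE mulr_sumr; apply: eq_bigr => t _; rewrite !mxE mulrCA.
Qed.

End Multimatrix.

(** * Marginals of supermaps *)

Section Marginal.
Variable C : numClosedFieldType.

Lemma ptr1_linear m n a (X Y : 'M[C]_(m * n)) :
  ptr1 (a *: X + Y) = a *: ptr1 X + ptr1 Y.
Proof.
apply/matrixP => i j; rewrite !mxE mulr_sumr -big_split; apply: eq_bigr => c _.
by rewrite !mxE.
Qed.

Lemma ptr1_0 m n : ptr1 (0 : 'M[C]_(m * n)) = 0.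
Proof. by apply/matrixP => i j; rewrite !mxE big1 // => c _; rewrite mxE. Qed.

Lemma ptr1_scalar m n (c : C) : ptr1 (c%:M : 'M_(m * n)) = (m%:R * c)%:M.
Proof.
apply/matrixP => i j; rewrite !mxE.
have [->|ne] := eqVneq i j.
  under eq_bigr do rewrite mxE eqxx.
  by rewrite sumr_const card_ord mulr1n mulr_natl.
rewrite big1 // => x _; rewrite mxE (can_eq (@mxtens_indexK m n)) xpair_eqE.
by rewrite (negPf ne) andbF.
Qed.

Lemma ptr1_adj m n (X : 'M[C]_(m * n)) : ptr1 (X^t*) = (ptr1 X)^t*.
Proof.
apply/matrixP => i j; rewrite !mxE rmorph_sum; apply: eq_bigr => c _.
by rewrite !mxE.
Qed.

Lemma ptr1_delta m n (y y' : 'I_m) (v v' : 'I_n) :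
  ptr1 (delta_mx (mxtens_index (y, v)) (mxtens_index (y', v')) : 'M[C]__) =
  (y == y')%:R *: delta_mx v v'.
Proof.
apply/matrixP => i j; rewrite !mxE (bigD1 y) //= big1 ?addr0 => [|x nx].
  rewrite mxE !(can_eq (@mxtens_indexK m n)) !xpair_eqE eqxx /= -natrM mulnb.
  by rewrite andbCA.
by rewrite mxE (can_eq (@mxtens_indexK m n)) xpair_eqE (negPf nx).
Qed.

Section Def.
Variables (I J : finType) (d : I -> nat) (e : J -> nat).

Definition marg (X : HomS C d e) : mm C d := fun i => \sum_j @ptr1 C (e j) (d i) (X (j, i)).

Lemma marg_linear : mm_linear (marg : mm C (homdim d e) -> mm C d).
Proof.
move=> a X Y; apply: functional_extensionality_dep => i.
rewrite /marg /mm_add /mm_scale scaler_sumr -big_split; apply: eq_bigr => j _.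
exact: ptr1_linear.
Qed.

Lemma marg_emb j i (Z : 'M[C]_(e j * d i)) :
  marg (@mm_emb C _ (homdim d e) (j, i) Z) = mm_emb (ptr1 Z).
Proof.
apply: functional_extensionality_dep => i'; rewrite /marg.
have [<-|ne] := eqVneq i i'.
  rewrite mm_emb_id (bigD1 j) //= big1 ?addr0 => [|j' nj].
    by rewrite (@mm_emb_id C _ (homdim d e) (j, i)).
  rewrite (@mm_emb_neq C _ (homdim d e)) ?ptr1_0 //.
  by rewrite xpair_eqE eq_sym (negPf nj).
rewrite (mm_emb_neq _ ne) big1 // => j' _.
rewrite (@mm_emb_neq C _ (homdim d e)) ?ptr1_0 //.
by rewrite xpair_eqE (negPf ne) andbF.
Qed.

Lemma TPcond_marg (X : HomS C d e) : TPcond X <-> marg X = fun=> 1%:M.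
Proof.
split=> [h|h i]; first exact: functional_extensionality_dep.
exact: (congr1 (fun Y : mm C d => Y i) h).
Qed.

End Def.

Section Supermap.
Variables (I J K L : finType).
Variables (dI : I -> nat) (dJ : J -> nat) (dK : K -> nat) (dL : L -> nat).
Variable S : HomS C dI dJ -> HomS C dK dL.
Hypotheses (hJ : (0 < #|J|)%N) (hdJ : forall j, (0 < dJ j)%N).
Hypothesis hS : det_supermap S.

Lemma marg_supermap_linear :
  mm_linear ((fun X => marg (S X)) : mm C (homdim dI dJ) -> mm C dK).
Proof.
case: hS => lS _ _ a X Y; rewrite lS.
exact: (@marg_linear _ _ dK dL).
Qed.

(* A Hermitian [X] of zero marginal is, up to a positive factor, the difference
   of the two (TP) elements proportional to [c%:M + X] and [c%:M]. *)
Lemma marg_supermap_herm0 (X : HomS C dI dJ) :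
  (forall p, (X p)^t* = X p) -> marg X = (fun=> 0) -> marg (S X) = (fun=> 0).
Proof.
move=> hX mX; case: hS => lS cS tS.
pose b p := \sum_a `|spectral_diag (X p) 0 a|.
have b0 p : 0 <= b p by rewrite sumr_ge0.
(* [c] dominates the eigenvalues of every block, and the summand 1 keeps it positive. [D] is the
   total output dimension, so [c%:M] has marginal [D * c] and [r] normalises it. *)
pose c := 1 + \sum_p b p; pose D : C := \sum_j (dJ j)%:R.
have c0 : 0 < c by rewrite ltr_pwDl ?ltr01 ?sumr_ge0.
have D0 : 0 < D.
  case/card_gt0P: hJ => j _; rewrite /D (bigD1 j) //=.
  by rewrite ltr_pwDl ?ltr0n ?sumr_ge0 // => j' _; rewrite ler0n.
pose r := (D * c)^-1; have r0 : 0 < r by rewrite invr_gt0 mulr_gt0.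
pose X0 : HomS C dI dJ := fun p => (r * c)%:M.
pose X1 : HomS C dI dJ := mm_add (mm_scale r X) X0.
have m0 : marg X0 = fun=> 1%:M.
  apply: functional_extensionality_dep => i; rewrite /marg /X0.
  under eq_bigr do rewrite ptr1_scalar.
  rewrite -raddf_sum -mulr_suml -/D; congr (_%:M).
  by rewrite mulrCA mulVf // mulf_neq0 ?gt_eqF.
have m1 : marg X1 = fun=> 1%:M.
  rewrite (@marg_linear _ _ dI dJ) mX m0.
  by apply: functional_extensionality_dep => i; rewrite /mm_add /mm_scale scaler0 add0r.
have p0 : mm_pos X0.
  by move=> p; rewrite /X0 -scalemx1; apply/psdZ/psd1; rewrite mulr_ge0 // ltW.
have p1 : mm_pos X1.
  move=> p; rewrite /X1 /mm_add /mm_scale /X0 -scale_scalar_mx -scalerDr addrC.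
  apply: psdZ; first exact: ltW.
  apply: herm_shift_psd => //; rewrite -/(b p) /c (bigD1 p) //= addrCA lerDl.
  by rewrite addr_ge0 ?ler01 ?sumr_ge0.
have /TPcond_marg t0 := tS _ p0 (proj2 (TPcond_marg _) m0).
have /TPcond_marg t1 := tS _ p1 (proj2 (TPcond_marg _) m1).
(* Both images have marginal 1, so linearity leaves [r *: marg (S X) = 0] with [r] nonzero. *)
have := marg_supermap_linear r X X0; rewrite -/X1 t0 t1 => h.
apply: functional_extensionality_dep => k.
have := congr1 (fun Y : mm C dK => Y k) h; rewrite /mm_add /mm_scale /=.
move=> /(congr1 (fun Y => Y - 1%:M)); rewrite addrK subrr => /esym/eqP.
by rewrite scaler_eq0 gt_eqF //= => /eqP.
Qed.

(** [X] is a combination of [X + X^t*] and ['i *: X - 'i *: X^t*], which are Hermitian and again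
    have zero marginal. *)
Lemma marg_supermap0 (X : HomS C dI dJ) :
  marg X = (fun=> 0) -> marg (S X) = (fun=> 0).
Proof.
move=> mX.
have mX' : marg (fun p => (X p)^t*) = (fun=> 0).
  apply: functional_extensionality_dep => i.
  have := congr1 (fun Y : mm C dI => (Y i)^t*) mX.
  rewrite /marg /= !raddf_sum /= trmx0 map_mx0 => h0.
  rewrite -[RHS]h0; apply: eq_bigr => j _.
  exact: ptr1_adj.
have h (a : C) : marg (S (fun p => a *: X p + a^* *: (X p)^t*)) = fun=> 0.
  apply: marg_supermap_herm0.
    by move=> p; rewrite adjD !adjZ trmxCK conjCK addrC.
  apply: functional_extensionality_dep => i.
  have e1 := congr1 (fun Y : mm C dI => a *: Y i) mX.
  have e2 := congr1 (fun Y : mm C dI => a^* *: Y i) mX'.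
  have := congr2 +%R e1 e2; rewrite /= !scaler0 addr0 => h0; rewrite -[RHS]h0.
  rewrite /marg !scaler_sumr -big_split; apply: eq_bigr => j _ /=.
  have := ptr1_linear a (X (j, i) : 'M_(dJ j * dI i)) (a^* *: (X (j, i))^t*).
  move=> ->; congr (_ + _).
  have := ptr1_linear (a^*) ((X (j, i))^t* : 'M_(dJ j * dI i)) 0.
  by rewrite ptr1_0 !addr0.
pose H1 : HomS C dI dJ := fun p => 1 *: X p + 1^* *: (X p)^t*.
pose H2 : HomS C dI dJ := fun p => 'i *: X p + 'i^* *: (X p)^t*.
(* The zero summand only provides the shape that [mm_linear] rewrites. *)
pose H3 : HomS C dI dJ := mm_add (mm_scale (- (2^-1 * 'i)) H2) (fun=> 0).
have h1 : marg (S H1) = fun=> 0 := h 1.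
have h2 : marg (S H2) = fun=> 0 := h 'i.
have l0 : marg (S (fun=> 0)) = fun=> 0.
  apply: functional_extensionality_dep => k.
  exact: (mm_linear0 marg_supermap_linear).
have h3 : marg (S H3) = fun=> 0.
  rewrite [LHS]marg_supermap_linear h2 l0.
  by apply: functional_extensionality_dep => k; rewrite /mm_add /mm_scale scaler0 addr0.
have -> : X = mm_add (mm_scale 2^-1 H1) H3.
  apply: functional_extensionality_dep => p.
  rewrite /mm_add /mm_scale /H3 /H1 /H2 /mm_add /mm_scale conjC1 conjCi.
  apply/matrixP => x y; rewrite !mxE.
  set u := X p x y; set v := (_^*).
  have i2 : 'i * 'i = -1 :> C by rewrite -expr2 sqrCi.
  have -> : - (2^-1 * 'i) * ('i * u + - 'i * v) = 2^-1 * ('i * 'i) * (v - u) by ring.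
  by rewrite i2; field.
rewrite [LHS]marg_supermap_linear h1 h3.
by apply: functional_extensionality_dep => k; rewrite /mm_add /mm_scale scaler0 addr0.
Qed.

End Supermap.
End Marginal.

(** * Dilation *)

Section Slices.
Variable C : numClosedFieldType.

(** Rows of [A] are indexed by K_out (x) K_in and columns by H_out (x) H_in. Fixing [x] in K_out and
    [y] in H_out leaves a vector of H_in (x) K_in, with the H_in factor first. *)
Definition slice m n p q (A : 'M[C]_(m * n, p * q)) x y : 'cV[C]_(q * n) :=
  \col_z A (mxtens_index (x, (mxtens_unindex z).2))
           (mxtens_index (y, (mxtens_unindex z).1)).

(** The component of [N] at the basis vector [u] of K_in, an operator from P to H_in. *)
Definition krow q n r (N : 'M[C]_(q * n, r)) (u : 'I_n) : 'M[C]_(q, r) :=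
  rowsub (fun v => mxtens_index (v, u)) N.

Lemma krow_mul q n r s (N : 'M[C]_(q * n, r)) (A : 'M[C]_(r, s)) u :
  krow (N *m A) u = krow N u *m A.
Proof.
by apply/matrixP => v b; rewrite !mxE; apply: eq_bigr => c _; rewrite mxE.
Qed.

Lemma adj_tens m n p q (A : 'M[C]_(m, n)) (B : 'M[C]_(p, q)) :
  (A *t B)^t* = A^t* *t B^t*.
Proof. by rewrite trmx_tens map_mxT. Qed.

Lemma tens11 m n : (1%:M : 'M[C]_m) *t (1%:M : 'M[C]_n) = 1%:M.
Proof.
apply: tens_mxP => x y x' y'; rewrite tensmxE !mxE -natrM mulnb.
by rewrite (can_eq (@mxtens_indexK m n)) xpair_eqE.
Qed.

Lemma tens1_mulE m n p q (A : 'M[C]_(n, p)) (B : 'M[C]_(m * p, q)) y b z :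
  ((1%:M *t A) *m B) (mxtens_index (y, b)) z =
  \sum_v A b v * B (mxtens_index (y, v)) z.
Proof.
rewrite mxE big_mxtens (bigD1 y) //= [X in _ + X]big1 ?addr0 => [|y' ny].
  by apply: eq_bigr => v _; rewrite tensmxE mxE eqxx mul1r.
by rewrite big1 // => v _; rewrite tensmxE mxE eq_sym (negPf ny) mul0r mul0r.
Qed.

Lemma mul_tens1E m n p q (A : 'M[C]_(p, n)) (B : 'M[C]_(q, m * p)) y b z :
  (B *m (1%:M *t A)) z (mxtens_index (y, b)) =
  \sum_v B z (mxtens_index (y, v)) * A v b.
Proof.
rewrite mxE big_mxtens (bigD1 y) //= [X in _ + X]big1 ?addr0 => [|y' ny].
  by apply: eq_bigr => v _; rewrite tensmxE mxE eqxx mul1r.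
by rewrite big1 // => v _; rewrite tensmxE mxE (negPf ny) mul0r mulr0.
Qed.

(** An entry of [A *m c *m B^t*] depends on one row of [A] and one row of [B] only, whatever the
    heights of the matrices. *)
Lemma form_rows m n p q r (A : 'M[C]_(m, p)) (A' : 'M[C]_(n, p))
    (B : 'M[C]_(q, p)) (B' : 'M[C]_(r, p)) (c : 'M[C]_p) a a' b b' :
  row a A = row b A' -> row a' B = row b' B' ->
  (A *m c *m B^t*) a a' = (A' *m c *m B'^t*) b b'.
Proof.
move=> /rowP hA /rowP hB; rewrite mxE [RHS]mxE; apply: eq_bigr => z _.
rewrite !mxE; have := hB z; rewrite !mxE => ->; congr (_ * _).
by apply: eq_bigr => w _; have := hA w; rewrite !mxE => ->.
Qed.

(** The hypothesis says that row [(x, u)] of [Mt] is row [x] of [G *m (1%:M *t (krow N u)^T)].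
    Contracting K_in with [rho] thus splits one Kraus term of the supermap into an encoder part,
    built from [N], and a decoder part [G]. *)
Lemma kraus_contract l k j i p (Mt : 'M[C]_(l * k, j * i)) (G : 'M[C]_(l, j * p))
    (N : 'M[C]_(i * k, p)) (c : 'M[C]_(j * i)) (rho : 'M[C]_k) x x' :
  (forall x y, slice Mt x y = N *m \col_b G x (mxtens_index (y, b))) ->
  \sum_u \sum_u' rho u u' *
    (Mt *m c *m Mt^t*) (mxtens_index (x, u)) (mxtens_index (x', u')) =
  (G *m (\sum_u \sum_u' rho u u' *:
    ((1%:M *t (krow N u)^T) *m c *m (1%:M *t (krow N u')^T)^t*)) *m G^t*) x x'.
Proof.
move=> h.
have hM x0 u : row (mxtens_index (x0, u)) Mt = row x0 (G *m (1%:M *t (krow N u)^T)).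
  apply/rowP => z; case: (mxtens_indexP z) => y v.
  rewrite !mxE; have := congr1 (fun V : 'cV[C]_(i * k) => V (mxtens_index (v, u)) 0) (h x0 y).
  rewrite !mxE mxtens_indexK /= => ->.
  have := mul_tens1E (krow N u)^T G y v x0; rewrite mxE => ->.
  by apply: eq_bigr => b _; rewrite !mxE mulrC.
have e u u' : (Mt *m c *m Mt^t*) (mxtens_index (x, u)) (mxtens_index (x', u')) =
   (G *m ((1%:M *t (krow N u)^T) *m c *m (1%:M *t (krow N u')^T)^t*) *m G^t*) x x'.
  rewrite (form_rows _ (hM x u) (hM x' u')) adjM !mulmxA.
  by [].
rewrite mulmx_sumr mulmx_suml summxE; apply: eq_bigr => u _.
rewrite mulmx_sumr mulmx_suml summxE; apply: eq_bigr => u' _.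
by rewrite e -scalemxAr -scalemxAl [RHS]mxE.
Qed.

(** The complement of an orthogonal projection is one too, and transposing it or tensoring it with
    an identity keeps it so. *)
Lemma compl_proj_tens m p (D : 'M[C]_p) : D^t* = D -> D *m D = D ->
  ((1%:M : 'M[C]_m) *t (1%:M - D)^T)^t* *m (1%:M *t (1%:M - D)^T) =
  1%:M *t (1%:M - D)^T.
Proof.
move=> hD DD; rewrite adj_tens adj1 tensmx_mul mul1mx; congr (_ *t _).
have -> : ((1%:M - D)^T)^t* = ((1%:M - D)^t*)^T by rewrite map_trmx.
rewrite -trmx_mul adjB adj1 hD mulmxBl mul1mx mulmxBr mulmx1 DD.
by rewrite subrr subr0.
Qed.

(** Kraus operators of applying [Q] and then replacing the result by the basis state [x0]. *)
Lemma sum_delta_conj m n p (x0 : 'I_n) (Q : 'M[C]_(m, p)) :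
  \sum_z (delta_mx x0 z *m Q)^t* *m (delta_mx x0 z *m Q) = Q^t* *m Q.
Proof.
under eq_bigr do rewrite adjM trmx_delta map_delta_mx -mulmxA
  [delta_mx _ _ *m (_ *m _)]mulmxA mul_delta_mx.
by rewrite -mulmx_sumr -mulmx_suml -mx1_sum_delta mul1mx.
Qed.

(** [P *m A *m P^t* = 0] is a sum of the positive matrices [P w w^* P^*], so each of them vanishes.
    With [P] the complement of a range projection, this places every [w] in the range of [A]. *)
Lemma sum3_gram_eq0 m n (L' : finType) (T : L' -> finType) (X : forall l, finType)
    (P : 'M[C]_(m, n)) (w : forall l, T l -> X l -> 'cV[C]_n) (A : 'M[C]_n) :
  \sum_l \sum_t \sum_x w l t x *m (w l t x)^t* = A -> P *m A = 0 ->
  forall l t x, P *m w l t x = 0.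
Proof.
move=> eA PA l t x.
have pg l0 t0 x0 : psd (P *m w l0 t0 x0 *m (P *m w l0 t0 x0)^t*) by apply: psd_gram.
have h : \sum_l \sum_t \sum_x P *m w l t x *m (P *m w l t x)^t* = 0.
  rewrite -[RHS](mul0mx _ (P^t*)) -PA -eA mulmx_sumr mulmx_suml.
  apply: eq_bigr => l0 _; rewrite mulmx_sumr mulmx_suml; apply: eq_bigr => t0 _.
  rewrite mulmx_sumr mulmx_suml; apply: eq_bigr => x0 _.
  by rewrite adjM !mulmxA.
have {}h := psd_sum_eq0 (fun l => @psd_sum _ _ _ _ _ _
  (fun t _ => @psd_sum _ _ _ _ _ _ (fun x _ => pg l t x))) h l.
have {}h := psd_sum_eq0 (fun t => @psd_sum _ _ _ _ _ _ (fun x _ => pg l t x)) h t.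
have {}h := psd_sum_eq0 (pg l t) h x.
by apply: gram_eq0 => i; rewrite h mxE.
Qed.

(** [V] is [N] with its K_in leg turned into an input, i.e. the encoder from K_in to H_in (x) P; the
    right-hand side is the input that [kraus_contract] hands to the decoder. *)
Lemma tens_id_krow (I J : finType) (d : I -> nat) (e : J -> nat)
    (f : mm C d -> mm C e) i j k p (N : 'M[C]_(d i * k, p)) (rho : 'M[C]_k)
    (V := \matrix_(z, u) N (mxtens_index ((mxtens_unindex z).1, u)) (mxtens_unindex z).2
       : 'M[C]_(d i * p, k)) :
  mm_linear f ->
  tens_id p f (@mm_emb C I (fun i => (d i * p)%N) i (V *m rho *m V^t*)) j =
  \sum_u \sum_u' rho u u' *:
    ((1%:M *t (krow N u)^T) *m (choi f (j, i) : 'M_(e j * d i)) *m (1%:M *t (krow N u')^T)^t*).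
Proof.
move=> lf; apply: tens_mxP => y b y' b'.
rewrite (tens_id_emb lf) (mm_linear_emb lf) summxE.
pose g u u' v v' := rho u u' * (N (mxtens_index (v, u)) b *
  choi f (j, i) (mxtens_index (y, v)) (mxtens_index (y', v')) *
  (N (mxtens_index (v', u')) b')^*).
transitivity (\sum_v \sum_v' \sum_u \sum_u' g u u' v v').
  apply: eq_bigr => v _; rewrite summxE; apply: eq_bigr => v' _.
  rewrite mxE -choiE !mxE mulr_suml exchange_big; apply: eq_bigr => u' _ /=.
  rewrite !mxE mulr_suml mulr_suml; apply: eq_bigr => u _.
  by rewrite !mxE !mxtens_indexK /g /=; ring.
under eq_bigr do rewrite exchange_big; rewrite exchange_big summxE; apply: eq_bigr => u _.
under eq_bigr do rewrite exchange_big; rewrite exchange_big summxE.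
apply: eq_bigr => u' _.
rewrite mxE adj_tens adj1 mul_tens1E mulr_sumr exchange_big; apply: eq_bigr => v' _ /=.
rewrite tens1_mulE mulr_suml mulr_sumr; apply: eq_bigr => v _.
by rewrite /g !mxE.
Qed.

End Slices.

(** * Gram matrices of the Kraus operators of a supermap *)

Section Dilation.
Variable C : numClosedFieldType.
Variables (I J K L : finType).
Variables (dI : I -> nat) (dJ : J -> nat) (dK : K -> nat) (dL : L -> nat).
Variable S : HomS C dI dJ -> HomS C dK dL.
Hypotheses (hJ : (0 < #|J|)%N) (hdJ : forall j, (0 < dJ j)%N).
Hypothesis hS : det_supermap S.

Definition unit_elt j i (y y' : 'I_(dJ j)) (v v' : 'I_(dI i)) : HomS C dI dJ :=
  @mm_emb C _ (homdim dI dJ) (j, i)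
    (delta_mx (mxtens_index (y, v)) (mxtens_index (y', v'))).

(** A matrix unit has marginal [delta_mx v v'] in block [i] if [y = y'] and 0 otherwise, so the
    combination [X] below has zero marginal and [marg_supermap0] applies. *)
Lemma marg_supermap_unit_elt j j0 i y y' y0 v v' k :
  marg (S (@unit_elt j i y y' v v')) k =
  (y == y')%:R *: marg (S (@unit_elt j0 i y0 y0 v v')) k.
Proof.
pose X : HomS C dI dJ :=
  mm_add (mm_scale (- (y == y')%:R) (@unit_elt j0 i y0 y0 v v')) (unit_elt y y' v v').
have mX : marg X = fun=> 0.
  rewrite [LHS](@marg_linear _ _ _ dI dJ) !marg_emb !ptr1_delta eqxx scale1r.
  apply: functional_extensionality_dep => i'; rewrite /mm_add /mm_scale.
  have [<-|ne] := eqVneq i i'; last by rewrite !mm_emb_neq ?scaler0 ?addr0.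
  by rewrite !mm_emb_id scaleNr addNr.
have := congr1 (fun Y : mm C dK => Y k) (marg_supermap0 hJ hdJ hS mX).
rewrite (marg_supermap_linear hS) /mm_add /mm_scale /= scaleNr addrC => /eqP.
by rewrite subr_eq0 => /eqP.
Qed.

(** The units sum to the Choi operator of the channel that discards its input and prepares the basis
    state [y0] of block [j0]; its image satisfies (TP). *)
Lemma marg_supermap_unit_sum j0 (y0 : 'I_(dJ j0)) k :
  \sum_i \sum_v marg (S (@unit_elt j0 i y0 y0 v v)) k = 1%:M.
Proof.
(* The coefficients 1 put the sums into the form required by [mm_linear_sum]. *)
pose X : HomS C dI dJ := fun p => \sum_i 1 *: \sum_v 1 *: @unit_elt j0 i y0 y0 v v p.
have lin (f : HomS C dI dJ -> mm C dK) (hf : mm_linear (f : mm C (homdim dI dJ) -> _)) k' :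
    f X k' = \sum_i \sum_v f (@unit_elt j0 i y0 y0 v v) k'.
  rewrite /X (mm_linear_sum hf (fun=> 1)
    (fun i p => \sum_v 1 *: @unit_elt j0 i y0 y0 v v p)).
  apply: eq_bigr => i _; rewrite scale1r (mm_linear_sum hf).
  by apply: eq_bigr => v _; rewrite scale1r.
rewrite -(lin (fun X => marg (S X))); last exact: marg_supermap_linear.
case: hS => _ _ tS; apply: tS.
  move=> p; apply: psd_sum => i _; rewrite scale1r; apply: psd_sum => v _.
  rewrite scale1r; apply: (@mm_emb_pos C _ (homdim dI dJ) (j0, i)).
  rewrite -(mul_delta_mx (0 : 'I_1)).
  have := psd_gram (delta_mx (mxtens_index (y0, v)) (0 : 'I_1) : 'M[C]__).
  by rewrite trmx_delta map_delta_mx.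
apply/TPcond_marg; apply: functional_extensionality_dep => i.
rewrite /X (mm_linear_sum (@marg_linear _ _ _ dI dJ) (fun=> 1)
    (fun i p => \sum_v 1 *: @unit_elt j0 i y0 y0 v v p)).
rewrite (bigD1 i) //= [X in _ + X]big1 ?addr0 => [|i' ni].
  rewrite scale1r (mm_linear_sum (@marg_linear _ _ _ dI dJ)).
  rewrite scalar_mx_sum_delta; apply: eq_bigr => v _.
  by rewrite !scale1r marg_emb ptr1_delta eqxx scale1r mm_emb_id.
rewrite scale1r (mm_linear_sum (@marg_linear _ _ _ dI dJ)) big1 // => v _.
by rewrite marg_emb mm_emb_neq ?scaler0.
Qed.

Section Gram.
Variables (n : nat) (M : forall (q : L * K) (p : J * I), 'I_n ->
  'M[C]_(homdim dK dL q, homdim dI dJ p)).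
Hypothesis hM : forall X, S X = kraus M X.

Definition kslice l k j i t x y : 'cV[C]_(dI i * dK k) :=
  @slice C (dL l) (dK k) (dJ j) (dI i) (M (l, k) (j, i) t) x y.

(** Each Kraus operator maps a matrix unit to a product of one of its columns with the adjoint of
    another; tracing out K_out sums over [x]. Reading [v], [v'] as matrix indices turns the
    marginals into Gram matrices. *)
Lemma marg_unit_elt_kraus j i y y' v v' k u u' :
  marg (S (@unit_elt j i y y' v v')) k u u' =
  (\sum_l \sum_t \sum_(x < dL l) kslice k i t x y *m (kslice k i t x y')^t*)
     (mxtens_index (v, u)) (mxtens_index (v', u')).
Proof.
rewrite hM /marg !summxE; apply: eq_bigr => l _; rewrite kraus_emb summxE.
rewrite [LHS]mxE; under eq_bigr do rewrite summxE.
rewrite exchange_big; apply: eq_bigr => t _ /=; rewrite summxE; apply: eq_bigr => x _.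
rewrite !mxE big_ord1 !mxE !mxtens_indexK /=.
rewrite (bigD1 (mxtens_index (y', v'))) //= big1 ?addr0 => [|z nz].
  rewrite !mxE (bigD1 (mxtens_index (y, v))) //= big1 ?addr0 => [|z nz].
    by rewrite !mxE !eqxx mulr1.
  by rewrite !mxE (negPf nz) mulr0.
rewrite !mxE big1 ?mul0r // => z' _.
by rewrite !mxE (negPf nz) andbF mulr0.
Qed.

Lemma supermap_gram : exists nn : forall k i, 'M[C]_(dI i * dK k),
  [/\ forall k i j (y y' : 'I_(dJ j)), \sum_l \sum_t \sum_(x < dL l)
        kslice k i t x y *m (kslice k i t x y')^t* =
        (y == y')%:R *: nn k i,
      forall k i, psd (nn k i)
    & forall k u u', \sum_i \sum_v
        nn k i (mxtens_index (v, u)) (mxtens_index (v, u')) = (u == u')%:R].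
Proof.
case/card_gt0P: (hJ) => j0 _; pose y0 := Ordinal (hdJ j0).
(* The Gram matrix at the reference vector [y0]; by [marg_supermap_unit_elt] any other choice gives
   the same matrix. *)
exists (fun k i => \sum_l \sum_t \sum_(x < dL l) kslice k i t x y0 *m (kslice k i t x y0)^t*).
split=> [k i j y y'|k i|k u u'].
- apply: tens_mxP => v u v' u'.
  rewrite -marg_unit_elt_kraus (marg_supermap_unit_elt _ _ y0) mxE.
  by rewrite marg_unit_elt_kraus [RHS]mxE.
- do 3![apply: psd_sum => ? _]; exact: psd_gram.
- have := congr1 (fun A : 'M[C]_(dK k) => A u u') (marg_supermap_unit_sum y0 k).
  rewrite summxE [RHS]mxE => <-; apply: eq_bigr => i _.
  by rewrite summxE; apply: eq_bigr => v _; rewrite marg_unit_elt_kraus.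
Qed.

End Gram.
End Dilation.

(** * Construction of the encoder and the decoder *)

Lemma sum_unit (V : nmodType) (F : unit -> V) : \sum_t F t = F tt.
Proof. by rewrite (bigD1 tt) //= big1 ?addr0 // => -[]. Qed.

Theorem theorem1p2 (C : numClosedFieldType) (I J K L : finType)
  (dI : I -> nat) (dJ : J -> nat) (dK : K -> nat) (dL : L -> nat)
  (hI : (0 < #|I|)%N) (hJ : (0 < #|J|)%N) (hK : (0 < #|K|)%N) (hL : (0 < #|L|)%N)
  (hdI : forall i, (0 < dI i)%N) (hdJ : forall j, (0 < dJ j)%N)
  (hdK : forall k, (0 < dK k)%N) (hdL : forall l, (0 < dL l)%N)
  (S : HomS C dI dJ -> HomS C dK dL) :
  det_supermap S ->
  exists (p : nat), [/\ (0 < p)%N, (p <= \max_(t : I * K) (dI t.1 * dK t.2))%N &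
  exists (E : mm C dK -> mm C (fun i => (dI i * p)%N)),
  exists (G : mm C (fun t : I * K * J => (dJ t.2 * p)%N) -> mm C dL),
    [/\ channel E, channel G &
      forall F : mm C dI -> mm C dJ, channel F ->
      forall SF : mm C dK -> mm C dL, mm_linear SF -> choi SF = S (choi F) ->
      forall rho : mm C dK,
        SF rho = G (fun t : I * K * J =>
          tens_id p F
            (mm_emb (E (mm_emb (rho t.1.2)) t.1.1)) t.2)]].
Proof.
move=> hS; case: (hS) => lS cS _; have [n [M hM]] := CP_kraus lS cS.
have [nn [hg hp h1]] := supermap_gram hJ hdJ hS hM.
pose p := \max_(t : I * K) (dI t.1 * dK t.2).
have le_p k i : (dI i * dK k <= p)%N by apply: (leq_bigmax (i, k)).
(* The conditions form a boolean conjunction, so that [sigW] extracts factors for all [k] and [i]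
   from mere existence. *)
have fac k i : {NN : 'M[C]_(dI i * dK k, p) * 'M[C]_(p, dI i * dK k) |
    [&& nn k i == NN.1 *m NN.1^t*, NN.1 *m NN.2 *m NN.1 == NN.1
      & (NN.2 *m NN.1)^t* == NN.2 *m NN.1]}.
  apply: sigW; have [N [N' [a b c]]] := psd_factor (le_p k i) (hp k i).
  by exists (N, N'); apply/and3P; split; apply/eqP.
pose N k i := (sval (fac k i)).1; pose N' k i := (sval (fac k i)).2.
(* The orthogonal projection of P onto the complement of the kernel of [N k i]. *)
pose D k i := N' k i *m N k i.
have hN k i : nn k i = N k i *m (N k i)^t* by case/and3P: (svalP (fac k i)) => /eqP.
have ND k i : N k i *m D k i = N k i.
  by rewrite mulmxA; case/and3P: (svalP (fac k i)) => _ /eqP.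
have Dadj k i : (D k i)^t* = D k i by case/and3P: (svalP (fac k i)) => _ _ /eqP.
have DD k i : D k i *m D k i = D k i by rewrite {1}/D -mulmxA ND.
(* [1 - N N'] kills [nn k i], hence each slice occurring in its Gram sum. *)
have rng k i l j t x y : kslice M k i t x y =
    N k i *m (N' k i *m kslice (l := l) (j := j) M k i t x y).
  have e := hg k i j y y; rewrite eqxx scale1r in e.
  have P0 : (1%:M - N k i *m N' k i) *m nn k i = 0.
    by rewrite hN mulmxBl mul1mx !mulmxA -[_ *m N' k i *m _]mulmxA ND subrr.
  have := sum3_gram_eq0 e P0 t x.
  by rewrite mulmxBl mul1mx mulmxA => /eqP; rewrite subr_eq0 => /eqP.
have p0 : (0 < p)%N.
  case/card_gt0P: hI => i _; case/card_gt0P: hK => k _.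
  by apply: leq_trans (le_p k i); rewrite muln_gt0 hdI hdK.
case/card_gt0P: (hL) => l0 _.
(* One Kraus operator per pair of blocks: [N k i] reshaped into a map from K_in to H_in (x) P. *)
pose ME (i : I) (k : K) (_ : unit) : 'M[C]_(dI i * p, dK k) :=
  \matrix_(z, u) N k i (mxtens_index ((mxtens_unindex z).1, u)) (mxtens_unindex z).2.
(* Row [x] lists the vectors [N' w] in P for the slices [w] at [x] and all [y]. *)
pose W l k i j (t : 'I_n) : 'M[C]_(dL l, dJ j * p) := \matrix_(x, z)
  (N' k i *m kslice M k i t x (mxtens_unindex z).1) (mxtens_unindex z).2 0.
pose Q k i j : 'M[C]_(dJ j * p) := 1%:M *t (1%:M - D k i)^T.
(* On the complement of the support, the decoder prepares the first basis state of block [l0]. *)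
pose MG l (q : I * K * J) (s : 'I_n + 'I_(dJ q.2 * p)) : 'M[C]_(dL l, dJ q.2 * p) :=
  match s with
  | inl t => W l q.1.2 q.1.1 q.2 t
  | inr z => (l == l0)%:R *: (delta_mx (Ordinal (hdL l)) z *m Q q.1.2 q.1.1 q.2)
  end.
have cE : channel (kraus ME).
  (* Completeness of the encoder is the normalisation of the partial traces of [nn]. *)
  apply: kraus_channel => k; apply/matrixP => u u'; rewrite [RHS]mxE eq_sym -h1.
  rewrite summxE; apply: eq_bigr => i _; rewrite sum_unit.
  rewrite mxE big_mxtens; apply: eq_bigr => v _; rewrite hN mxE.
  by apply: eq_bigr => b _; rewrite !mxE !mxtens_indexK mulrC.
have cG : channel (kraus MG).
  apply: kraus_channel => -[[i k] j] /=.
  (* The Gram relation conjugated by [N']: distinct [y], [y'] are orthogonal, and equal ones give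
     [N' nn N'^* = D]. *)
  have sW : \sum_l \sum_t (W l k i j t)^t* *m W l k i j t = 1%:M *t (D k i)^T.
    have eD : N' k i *m nn k i *m (N' k i)^t* = D k i.
      by rewrite hN !mulmxA -mulmxA -adjM -/(D k i) Dadj DD.
    apply: tens_mxP => y b y' b'.
    rewrite tensmxE [(_^T) b b']mxE [1%:M y y']mxE eq_sym.
    have := congr1 (fun A => (N' k i *m A *m (N' k i)^t*) b' b) (hg k i j y' y).
    rewrite /= -scalemxAr -scalemxAl eD [RHS]mxE => <-.
    rewrite summxE mulmx_sumr mulmx_suml summxE; apply: eq_bigr => l _.
    rewrite summxE mulmx_sumr mulmx_suml summxE; apply: eq_bigr => t _.
    rewrite mulmx_sumr mulmx_suml summxE mxE; apply: eq_bigr => x _.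
    rewrite !mulmxA -mulmxA -adjM [RHS]mxE big_ord1 !mxE !mxtens_indexK mulrC.
    by [].
  have sQ : \sum_l \sum_z
     ((l == l0)%:R *: (delta_mx (Ordinal (hdL l)) z *m Q k i j))^t* *m
     ((l == l0)%:R *: (delta_mx (Ordinal (hdL l)) z *m Q k i j)) = Q k i j.
    rewrite (bigD1 l0) //= [X in _ + X]big1 ?addr0 => [|l /negPf nl]; last first.
      by rewrite big1 // => z _; rewrite nl scale0r mulmx0.
    under eq_bigr do rewrite eqxx scale1r.
    by rewrite sum_delta_conj compl_proj_tens.
  (* The two families complement each other: [D^T + (1 - D)^T = 1]. *)
  under eq_bigr do rewrite big_sumType /=.
  rewrite big_split /= sW sQ /Q linearB /= trmx1.
  by apply: tens_mxP => y b y' b'; rewrite mxE !tensmxE -mulrDr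
    -(tens11 C (dJ j) p) tensmxE; congr (_ * _);
    move: (D k i) => A; rewrite !mxE addrCA subrr addr0.
exists p; split=> //; exists (kraus ME), (kraus MG); split=> // F [lF _ _] SF lSF eSF rho.
apply: functional_extensionality_dep => l; apply/matrixP => x x'.
rewrite (mm_linear_choi lSF) eSF hM /kraus summxE.
(* The block [(i, k, j)] of the decoder's input, expressed through the Choi operator of [F]. *)
pose om k i j := \sum_u \sum_u' rho k u u' *:
    ((1%:M *t (krow (N k i) u)^T) *m (choi F (j, i) : 'M_(dJ j * dI i))
       *m (1%:M *t (krow (N k i) u')^T)^t*).
have eom i k j : tens_id p F (@mm_emb C I (fun i => (dI i * p)%N) i
     (kraus ME (mm_emb (rho k)) i)) j = om k i j.
  rewrite kraus_emb sum_unit.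
  exact: tens_id_krow.
(* The operators [W] alone already reproduce the output; the completing operators are shown to
   contribute zero afterwards. *)
transitivity (\sum_k \sum_(q : J * I) \sum_t
    (W l k q.2 q.1 t *m om k q.2 q.1 *m (W l k q.2 q.1 t)^t*) x x').
  apply: eq_bigr => k _.
  under eq_bigr => u _ do under eq_bigr => u' _ do rewrite summxE mulr_sumr.
  under eq_bigr => u _ do rewrite exchange_big.
  rewrite exchange_big; apply: eq_bigr => -[j i] _ /=.
  under eq_bigr => u _ do under eq_bigr => u' _ do rewrite summxE mulr_sumr.
  under eq_bigr => u _ do rewrite exchange_big.
  rewrite exchange_big; apply: eq_bigr => t _ /=.
  apply: kraus_contract => x0 y; rewrite -[LHS]/(kslice M k i t x0 y) rng.
  by congr (_ *m _); apply/colP => b; rewrite [RHS]mxE [RHS]mxE mxtens_indexK.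
rewrite pair_big /= (reindex (fun q : I * K * J => (q.1.2, (q.2, q.1.1)))) /=; last first.
  by exists (fun r : K * (J * I) => (r.2.2, r.1, r.2.1)) => [[[? ?] ?]|[? [? ?]]].
apply: eq_bigr => -[[i k] j] _ /=; rewrite eom big_sumType /= mxE summxE.
(* Actual inputs lie in the support of the projection, because [N *m (1%:M - D) = 0]. *)
have Qom : Q k i j *m om k i j = 0.
  rewrite mulmx_sumr big1 // => u _; rewrite mulmx_sumr big1 // => u' _.
  rewrite -scalemxAr !mulmxA tensmx_mul mul1mx -trmx_mul -krow_mul.
  rewrite mulmxBr mulmx1 ND subrr /krow raddf0 trmx0 tensmx0.
  by rewrite !mul0mx scaler0.
rewrite [X in _ = _ + fun_of_matrix X _ _]big1 => [|z _].
  by rewrite [X in _ = _ + X]mxE addr0.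
by rewrite -!scalemxAl -[_ *m Q k i j *m _]mulmxA Qom mulmx0 mul0mx scaler0.
Qed.
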